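(* Consider a structured problem in the class $\mathcal{SP}(m_f,\sigma_f,\bar\sigma_f,L,\delta)$ with $L(\cdot)=L\ge0$ constant, $\sigma_f=\bar\sigma_f=0$, and $\delta(y,x)=\frac{M(y)}\rho\|y-x\|^\rho$ for some $\rho\in[1,2)$ and a function $M(\cdot)\ge0$ on $Q$. Let $\{(z_{k-1},w_{k-1},x_k,\hat x_k)\}_{k\ge0}$ be generated by the modified method of Method S with $$\lambda_k:=\frac{k+1}2,\qquad\beta_k:=\frac L{\sigma_d}+\frac\gamma{\sigma_d}(k+3)^{\frac32(2-\rho)},\qquad\gamma>0.$$ Then for every $k\ge0$ $$f(\hat x_k)-f(x^* )\le\frac{4L\,l_d(z_k;x^* )}{\sigma_d(k+1)(k+2)}+\left[\frac{4\gamma\,l_d(z_k;x^* )}{\sigma_d}+\frac{\max_{0\le i\le k}M(x_i)^{\frac2{2-\rho}}}{3\rho\gamma^{\frac\rho{2-\rho}}}\right]\frac{(k+3)^{\frac32(2-\rho)}}{(k+1)(k+2)}.$$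
   Context: Setting. $E$ is a finite-dimensional real normed space with norm $\|\cdot\|$; $E^*$ is its dual, with pairing $\langle s,x\rangle$. $Q\subset E$ is a closed convex set and $f:E\to\mathbb R\cup\{+\infty\}$ is a lower-semicontinuous (lsc) convex function with $Q\subset \mathrm{dom} f$. The problem $\min_{x\in Q}f(x)$ is assumed to have an optimal solution; $x^*\in Q$ denotes one. A prox-function $d:E\to\mathbb R\cup\{+\infty\}$ is fixed: $d$ is nonnegative, continuously differentiable and strongly convex on $Q$ ($Q\subset\mathrm{dom}\,d$) with constant $\sigma_d>0$ with respect to $\|\cdot\|$, and $d(x_0)=\min_{x\in Q}d(x)=0$ for its unique minimizer $x_0\in Q$. For $x,y\in Q$: $l_d(y;x):=d(y)+\langle\nabla d(y),x-y\rangle$ and $\xi(y,x):=d(x)-l_d(y;x)$ (Bregman distance). For an lsc convex $\psi:E\to\mathbb R\cup\{+\infty\}$ with $Q\subset\mathrm{dom}\,\psi$, $\sigma(\psi):=\{\tau\ge0:\psi(x)-\tau d(x)\text{ is an lsc convex function on }Q\}$. Class $\mathcal{SP}(m_f,\sigma_f,\bar\sigma_f,L,\delta)$: problems $\min_{x\in Q}f(x)$ for which the following are given. For each $y\in Q$, $m_f(y;\cdot):E\to\mathbb R\cup\{+\infty\}$ is an lsc convex function (with $Q$ in its domain) with $m_f(y;x)\le f(x)$ for all $x\in Q$; $\sigma_f\ge0$ satisfies $\sigma_f\in\sigma(f)\cap\bigcap_{y\in Q}\sigma(m_f(y;\cdot))$; $\bar\sigma_f\in[0,\sigma_f]$; $L(\cdot)\ge0$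 is a function on $Q$; $\delta(y,\cdot)$ is a nonnegative convex function on $Q$ for each $y\in Q$; and $$f(x)\le[m_f(y;x)-\bar\sigma_f\xi(y,x)]+\tfrac{L(y)}2\|y-x\|^2+\delta(y,x)\quad\forall x,y\in Q.$$ Subproblems $\min_{x\in Q}\{m_f(y;x)+\langle s,x\rangle+\beta d(x)\}$ ($\beta\ge0$, $s\in E^*$) are assumed solvable ($Q$ is additionally assumed bounded when $\beta=0$ and $\sigma_f=0$). Parameters. Weight parameters $\lambda_k>0$ ($k\ge0$); scaling parameters $\beta_k\ge0$ ($k\ge-1$), nondecreasing in $k$. $S_k:=\sum_{i=0}^k\lambda_i$, $S_{-1}:=0$. Property 2 for a coupled sequence of functions $\{(\varphi_k(x),\psi_k(x))\}_{k\ge-1}$ (associated with $\{\lambda_k\},\{\beta_k\}$ and test points $\{x_k\}_{k\ge0}$), with $z_k:=\mathrm{argmin}_{x\in Q}\varphi_k(x)$, $w_k:=\mathrm{argmin}_{x\in Q}\psi_k(x)$ (minimizers assumed to exist): (B0) $\varphi_k(x)\ge\psi_k(x)$ for all $x\in Q$, $k\ge -1$. (B1) $\psi_{-1}(w_{-1})=0$ and $z_{-1}=w_{-1}=x_0$. (B2) For all $k\ge-1$, $x\in Q$: $\psi_{k+1}(x)\ge\varphi_k(z_k)+\lambda_{k+1}m_f(x_{k+1};x)+\beta_{k+1}d(x)-\beta_kl_d(z_k;x)+S_k\sigma_f\xi(z_k,x)$. (B3) For all $k\ge-1$: $\psi_k(w_k)\le\min_{x\in Q}\{\sum_{i=0}^k\lambda_im_f(x_i;x)+\beta_kl_d(z_k;x)-S_k\sigma_f\xi(z_k,x)\}$.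 Method S, modified variant. With a coupled sequence $\{(\varphi_k,\psi_k)\}_{k\ge-1}$ satisfying Property 2: set $x_0:=z_{-1}:=w_{-1}:=\mathrm{argmin}_{x\in Q}d(x)$, $z_0:=\mathrm{argmin}_{x\in Q}\varphi_0(x)$, $\hat x_0:=w_0:=\mathrm{argmin}_{x\in Q}\psi_0(x)$. For $k\ge0$ set $x_{k+1}:=\frac{S_k\hat x_k+\lambda_{k+1}z_k}{S_{k+1}}$, $z_{k+1}:=\mathrm{argmin}_{x\in Q}\varphi_{k+1}(x)$, $w_{k+1}:=\mathrm{argmin}_{x\in Q}\psi_{k+1}(x)$, $\hat x_{k+1}:=\frac{S_k\hat x_k+\lambda_{k+1}w_{k+1}}{S_{k+1}}$. *)

(* Defs.v *)
From mathcomp Require Import all_boot all_order all_algebra.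
From mathcomp Require Import all_classical all_reals all_analysis.

Set Implicit Arguments.
Unset Strict Implicit.
Unset Printing Implicit Defensive.

Import Order.TTheory GRing.Theory Num.Theory.
Import numFieldNormedType.Exports.

Local Open Scope classical_set_scope.
Local Open Scope ring_scope.

Definition finite_dimensional (R : realType) (E : normedModType R) : Prop :=
  exists (n : nat) (b : 'I_n -> E),
    forall x : E, exists c : 'I_n -> R, x = \sum_(i < n) c i *: b i.

Section Functions.
Context {R : realType} {E : normedModType R}.
Implicit Types (Q : set E) (f d psi : E -> \bar R) (x y : E).

(* The products below follow the convention 0 * +oo = 0. *)
Definition econvex_on Q f : Prop :=
  forall x y (t : R), Q x -> Q y -> 0 <= t <= 1 ->
    (f (t *: x + (1 - t) *: y)%R <= t%:E * f x + (1 - t)%:E * f y)%E.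

(* [subspace Q] carries the topology in which the points outside Q are
   isolated, so this is lower semicontinuity of the restriction of f to Q. *)
Definition lsc_on Q f : Prop :=
  lower_semicontinuous (f : subspace Q -> \bar R).

(* Functions E -> R u {+oo} are maps into \bar R that avoid -oo. *)
Definition lsc_convex f : Prop :=
  [/\ forall x, (-oo < f x)%E, lower_semicontinuous f & econvex_on setT f].

Definition dom f : set E := [set x | (f x < +oo)%E].

Definition is_argmin Q f x : Prop :=
  Q x /\ forall y, Q y -> (f x <= f y)%E.

Definition strongly_convex_on Q (sigma : R) f : Prop :=
  forall x y (t : R), Q x -> Q y -> 0 <= t <= 1 ->
    (f (t *: x + (1 - t) *: y)%R <=
       t%:E * f x + (1 - t)%:E * f y
       - (sigma / 2 * (t * (1 - t)) * `|x - y| ^+ 2)%:E)%E.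

(* In finite dimension every linear form is continuous, hence the dual space
   is {linear E -> R^o}.  Differentiability at the points of Q is taken along
   Q, so that d need not be finite outside Q; where Q has empty interior the
   gradient is not unique, and [grad] is one choice of it.  The last clause is
   continuity of [grad] along Q for the dual norm. *)
Definition continuously_differentiable_on Q d
    (grad : E -> {linear E -> R^o}) : Prop :=
  (forall y, Q y -> forall e : R, 0 < e ->
     \forall x \near within Q (nbhs y),
       `|fine (d x) - fine (d y) - grad y (x - y)| <= e * `|x - y|) /\
  (forall y, Q y -> forall e : R, 0 < e ->
     \forall y' \near within Q (nbhs y),
       forall h : E, `|grad y' h - grad y h| <= e * `|h|).

Record prox_function Q d (grad : E -> {linear E -> R^o}) (sigma_d : R)
    (x0 : E) : Prop := {
  prox_gtNy : forall x, (-oo < d x)%E ;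
  prox_dom : Q `<=` dom d ;
  prox_ge0 : forall x, Q x -> (0 <= d x)%E ;
  prox_diff : continuously_differentiable_on Q d grad ;
  prox_sigma_gt0 : 0 < sigma_d ;
  prox_strongly_convex : strongly_convex_on Q sigma_d d ;
  prox_argmin : is_argmin Q d x0 ;
  prox_argmin_uniq : forall x, is_argmin Q d x -> x = x0 ;
  prox_min0 : d x0 = 0%E
}.

Definition l_prox d (grad : E -> {linear E -> R^o}) (y x : E) : R :=
  fine (d y) + grad y (x - y).

Definition bregman d (grad : E -> {linear E -> R^o}) (y x : E) : R :=
  fine (d x) - l_prox d grad y x.

Definition sigma_set Q d psi : set R :=
  [set tau | 0 <= tau /\
     let g := fun x => (psi x - tau%:E * d x)%E in
     lsc_on Q g /\ econvex_on Q g].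

Record class_SP Q f d (grad : E -> {linear E -> R^o})
    (m_f : E -> E -> \bar R) (sigma_f bsigma_f : R) (L : E -> R)
    (delta : E -> E -> R) : Prop := {
  SP_model_lsc_convex : forall y, Q y -> lsc_convex (m_f y) ;
  SP_model_dom : forall y, Q y -> Q `<=` dom (m_f y) ;
  SP_model_le : forall y x, Q y -> Q x -> (m_f y x <= f x)%E ;
  SP_sigma_ge0 : 0 <= sigma_f ;
  SP_sigma : (sigma_set Q d f `&`
              \bigcap_(y in Q) sigma_set Q d (m_f y)) sigma_f ;
  SP_bsigma : 0 <= bsigma_f <= sigma_f ;
  SP_L_ge0 : forall y, Q y -> 0 <= L y ;
  SP_delta_ge0 : forall y x, Q y -> Q x -> 0 <= delta y x ;
  SP_delta_convex : forall y, Q y -> convex_function Q (delta y) ;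
  SP_upper : forall x y, Q x -> Q y ->
    (f x <= (m_f y x - (bsigma_f * bregman d grad y x)%:E)
            + (L y / 2 * `|y - x| ^+ 2 + delta y x)%:E)%E ;
  SP_solvable : forall y (s : {linear E -> R^o}) (beta : R),
    Q y -> 0 <= beta ->
    (beta = 0 -> sigma_f = 0 -> bounded_set Q) ->
    exists x, is_argmin Q (fun x => m_f y x + (s x)%:E + beta%:E * d x)%E x
}.

End Functions.

(* The partial sum of the first n weights: S_k of the text is
   [weight_sum lam k.+1], and S_{-1} is [weight_sum lam 0]. *)
Definition weight_sum (R : realType) (lam : nat -> R) (n : nat) : R :=
  \sum_(i < n) lam i.

Section Method.
Context {R : realType} {E : normedModType R}.

(* Sequences that start at index -1 (beta, phi, psi, z, w) are shifted by one:
   the term of index k is stored at position k.+1, and the term of index -1 at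
   position 0.  The sequences lam and xs start at index 0 and are not
   shifted. *)

Record parameters (lam beta : nat -> R) : Prop := {
  lam_gt0 : forall k, 0 < lam k ;
  beta_ge0 : forall n, 0 <= beta n ;
  beta_ndecr : forall n, beta n <= beta n.+1
}.

(* In [prop2_B2] and [prop2_B3], n stands for k + 1 with k >= -1. *)
Record property2 (Q : set E) (d : E -> \bar R)
    (grad : E -> {linear E -> R^o}) (x0 : E)
    (m_f : E -> E -> \bar R) (sigma_f : R) (lam beta : nat -> R)
    (xs : nat -> E) (phi psi : nat -> E -> \bar R) (z w : nat -> E) : Prop := {
  prop2_z : forall n, is_argmin Q (phi n) (z n) ;
  prop2_w : forall n, is_argmin Q (psi n) (w n) ;
  prop2_B0 : forall n x, Q x -> (psi n x <= phi n x)%E ;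
  prop2_B1_psi : psi 0%N (w 0%N) = 0%E ;
  prop2_B1_z : z 0%N = x0 ;
  prop2_B1_w : w 0%N = x0 ;
  prop2_B2 : forall n x, Q x ->
    (phi n (z n) + (lam n)%:E * m_f (xs n) x + (beta n.+1)%:E * d x
       - (beta n * l_prox d grad (z n) x)%:E
       + (weight_sum lam n * sigma_f * bregman d grad (z n) x)%:E
     <= psi n.+1 x)%E ;
  prop2_B3 : forall n,
    (psi n (w n) <= ereal_inf
      [set (\sum_(i < n) (lam i)%:E * m_f (xs i) x
            + (beta n * l_prox d grad (z n) x)%:E
            - (weight_sum lam n * sigma_f * bregman d grad (z n) x)%:E)%E
        | x in Q])%E
}.

(* That z and w are minimizers of phi and psi is part of [property2]. *)
Record modified_method_S (x0 : E) (lam : nat -> R)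
    (z w xs xhat : nat -> E) : Prop := {
  methodS_x0 : xs 0%N = x0 ;
  methodS_xhat0 : xhat 0%N = w 1%N ;
  methodS_x : forall k, xs k.+1 =
    (weight_sum lam k.+2)^-1 *:
      (weight_sum lam k.+1 *: xhat k + lam k.+1 *: z k.+1) ;
  methodS_xhat : forall k, xhat k.+1 =
    (weight_sum lam k.+2)^-1 *:
      (weight_sum lam k.+1 *: xhat k + lam k.+1 *: w k.+2)
}.

End Method.

(* Main.v *)
Require Import Defs.
From mathcomp Require Import all_boot all_order all_algebra.
From mathcomp Require Import all_classical all_reals all_analysis.
From mathcomp Require Import ring lra.

Set Implicit Arguments.
Unset Strict Implicit.
Unset Printing Implicit Defensive.

Import Order.TTheory GRing.Theory Num.Theory.
Import numFieldNormedType.Exports.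

Local Open Scope classical_set_scope.
Local Open Scope ring_scope.

(** With [S n] the sum of the first [n] weights and [u n] the output preceding
    step [n], the quantity [S n * f (u n) - sum of errors] stays below the
    minimum of [psi n].  In one step [xs n - xhat n] is the multiple
    [lam n / S n.+1] of [z n - w n.+1], and the strong convexity of [d] leaves
    in B2 a spare term [beta n * sigma_d / 2 * |z n - w n.+1| ^ 2].  It absorbs
    the quadratic error in full and, by Young's inequality with exponents
    [2 / rho] and [2 / (2 - rho)], the Hoelder error up to a multiple of
    [(n + 2) ^ (p - 1)], where [p = 3 / 2 * (2 - rho)].  These errors sum up to
    a multiple of [(k + 3) ^ p / p], and B3 at [xstar] concludes. *)

(** * Weighted averages, and the quadratic lower bound on the Bregman distance *)

Section Convexity.
Context {R : realType} {E : normedModType R}.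
Implicit Types (Q : set E) (f d : E -> \bar R) (x y : E) (a b t : R).

Lemma convex_set_comb Q x y t :
  convex_set Q -> Q x -> Q y -> 0 <= t <= 1 -> Q (t *: x + (1 - t) *: y).
Proof.
move=> cQ Qx Qy t01.
have /set_mem := cQ x y (Itv01 (andP t01).1 (andP t01).2) (mem_set Qx) (mem_set Qy).
by [].
Qed.

Lemma average_comb x y a b : a + b != 0 ->
  (a + b)^-1 *: (a *: x + b *: y) = (a / (a + b)) *: x + (1 - a / (a + b)) *: y.
Proof.
move=> ab0; rewrite scalerDr !scalerA mulrC; congr (_ + _ *: _).
by field.
Qed.

Lemma average_weight a b : 0 <= a -> 0 < b -> 0 <= a / (a + b) <= 1.
Proof.
move=> a0 b0; have ab0 : 0 < a + b by rewrite ltr_wpDl.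
by rewrite divr_ge0 ?(ltW ab0)//= ler_pdivrMr// mul1r lerDl ltW.
Qed.

Lemma convex_set_average Q x y a b : convex_set Q -> Q x -> Q y ->
  0 <= a -> 0 < b -> Q ((a + b)^-1 *: (a *: x + b *: y)).
Proof.
move=> cQ Qx Qy a0 b0; rewrite average_comb ?gt_eqF ?ltr_wpDl//.
by apply: convex_set_comb => //; exact: average_weight.
Qed.

(** Jensen's inequality with the denominator cleared. The case [a = 0] is allowed because the weight
    preceding step 0 vanishes. *)
Lemma econvex_average f x y a b : econvex_on setT f ->
  (forall x', (-oo < f x')%E) -> (f x < +oo)%E -> (f y < +oo)%E ->
  0 <= a -> 0 < b ->
  (a + b) * fine (f ((a + b)^-1 *: (a *: x + b *: y))) <=
    a * fine (f x) + b * fine (f y).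
Proof.
move=> cf fNy fx fy a0 b0; have ab0 : 0 < a + b by rewrite ltr_wpDl.
rewrite average_comb ?gt_eqF//.
have := cf x y (a / (a + b)) Logic.I Logic.I (average_weight a0 b0).
have /fineK <- : f x \is a fin_num by rewrite fin_real// fNy.
have /fineK <- : f y \is a fin_num by rewrite fin_real// fNy.
(* Convexity bounds the value at the average by a real number, so that value is finite too. *)
case: (f (_ + _)) (fNy ((a / (a + b)) *: x + (1 - a / (a + b)) *: y)) => //= c _.
rewrite lee_fin => /(ler_wpM2l (ltW ab0))/le_trans; apply.
rewrite le_eqVlt; apply/orP; left; apply/eqP.
by field; rewrite gt_eqF.
Qed.

(** By contradiction, with [g] the amount by which the bound fails: at a point of the segment close
    to [y], strong convexity bounds [d] from above and the first-order expansion at [y] along [Q],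
    with tolerance [g / (4 * N)], bounds it from below. Convexity of [Q] keeps the segment in
    [Q]. *)
Lemma bregman_ge Q d (grad : E -> {linear E -> R^o}) sigma_d x0 x y :
  convex_set Q -> prox_function Q d grad sigma_d x0 -> Q x -> Q y ->
  sigma_d / 2 * `|x - y| ^+ 2 <= bregman d grad y x.
Proof.
move=> cQ [dNy ddom _ [ddiff _] s0 dsc _ _ _] Qx Qy.
have dfin u : Q u -> d u \is a fin_num by move=> Qu; rewrite fin_real// dNy ddom.
have [->|xy] := eqVneq x y.
  by rewrite /bregman /l_prox subrr linear0 normr0 expr0n/= mulr0 addr0 subrr.
have N0 : 0 < `|x - y| by rewrite normr_gt0 subr_eq0.
set N := `|x - y| in N0 *; rewrite leNgt; apply/negP => gap.
pose g := sigma_d / 2 * N ^+ 2 - bregman d grad y x.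
have g0 : 0 < g by rewrite subr_gt0.
have e0 : 0 < g / (4 * N) by rewrite divr_gt0// mulr_gt0.
have /nbhs_ballP[r /= r0 near_y] := ddiff y Qy _ e0.
have sN0 : 0 < 2 * (sigma_d * N ^+ 2) by rewrite !mulr_gt0// exprn_gt0.
(* [t] is so small that the slack [g] would be at most [g / 2]. *)
pose t := Num.min 1 (Num.min (r / (2 * N)) (g / (2 * (sigma_d * N ^+ 2)))).
have t0 : 0 < t.
  by rewrite !lt_min ltr01 !divr_gt0// mulr_gt0.
have t1 : t <= 1 by rewrite ge_min lexx.
have tr : t * N < r.
  have : t <= r / (2 * N) by rewrite !ge_min lexx orbT.
  rewrite ler_pdivlMr ?mulr_gt0//; nra.
have tg : t * (2 * (sigma_d * N ^+ 2)) <= g.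
  by rewrite -ler_pdivlMr// !ge_min lexx !orbT.
have t01 : 0 <= t <= 1 by rewrite ltW.
have ytE : t *: x + (1 - t) *: y - y = t *: (x - y).
  by rewrite scalerBl scale1r addrA addrAC addrK scalerBr.
have Qyt : Q (t *: x + (1 - t) *: y) by exact: convex_set_comb.
have := near_y (t *: x + (1 - t) *: y).
rewrite -ball_normE /= distrC ytE normrZ gtr0_norm// -/N => /(_ tr Qyt).
rewrite linearZ/= ler_norml => /andP[lo _].
have := dsc x y t Qx Qy t01.
rewrite -(fineK (dfin _ Qyt)) -(fineK (dfin _ Qx)) -(fineK (dfin _ Qy)).
rewrite -!EFinM -EFinD lee_fin /= -/N => up.
have eN : g / (4 * N) * (t * N) = t * (g / 4) by field; rewrite gt_eqF.
rewrite eN in lo.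
have gE : g = sigma_d / 2 * N ^+ 2 - (fine (d x) - (fine (d y) + grad y (x - y))).
  by [].
move: lo up gE; rewrite /GRing.scale/=; move: (grad y (x - y) : R) => G lo up gE.
have : t * g <= t * (g / 2).
  have := ler_wpM2l (ltW t0) tg.
  nra.
rewrite ler_pM2l//; lra.
Qed.

End Convexity.

(** * Bernoulli and Young inequalities for real powers, and a power sum *)

Section Powers.
Context {R : realType}.
Implicit Types p rho a A r x : R.

(** Young's inequality for the product of [x] and 1, with exponents [p] and [p / (p - 1)]. *)
Lemma bernoulli_ge1 p x : 1 <= p -> 0 <= x -> 1 + p * (x - 1) <= x `^ p.
Proof.
rewrite le_eqVlt => /predU1P[<-|p1] x0; first by rewrite powRr1//; lra.
have p0 : 0 < p by lra.
have q0 : 0 < p / (p - 1) by rewrite divr_gt0//; lra.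
have pq : p^-1 + (p / (p - 1))^-1 = 1 by field; rewrite !gt_eqF//; lra.
have := conjugate_powR x0 ler01 p0 q0 pq.
rewrite powR1 mulr1 => /(ler_wpM2l (ltW p0)).
rewrite [leRHS](_ : _ = x `^ p + p - 1); first lra.
by field; rewrite !gt_eqF//; lra.
Qed.

(** Young's inequality for the product of [x^p] and 1, with exponents [1 / p] and [1 / (1 - p)]. *)
Lemma bernoulli_le1 p x : 0 < p <= 1 -> 0 <= x -> x `^ p <= 1 + p * (x - 1).
Proof.
move=> /andP[p0]; rewrite le_eqVlt => /predU1P[->|p1] x0.
  by rewrite powRr1//; lra.
have ip0 : 0 < p^-1 by rewrite invr_gt0.
have iq0 : 0 < (1 - p)^-1 by rewrite invr_gt0; lra.
have pq : p^-1^-1 + (1 - p)^-1^-1 = 1 by rewrite !invrK; lra.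
have := conjugate_powR (powR_ge0 x p) ler01 ip0 iq0 pq.
rewrite powR1 mulr1 -powRrM divff ?gt_eqF// powRr1// !invrK; lra.
Qed.

Lemma powR_pred (x p : R) : 0 < x -> x * x `^ (p - 1) = x `^ p.
Proof.
move=> x0; rewrite -[X in X * _](powRr1 (ltW x0)) -powRD ?(gt_eqF x0) ?implybT//.
by congr (_ `^ _); ring.
Qed.

Lemma sum_powR p (k : nat) : 0 < p ->
  \sum_(i < k) i.+2%:R `^ (p - 1) <= k.+2%:R `^ p / p.
Proof.
move=> p0.
have scale (x y : R) : 0 < x -> 0 <= y -> y `^ p = x `^ p * (y / x) `^ p.
  move=> x0 y0; rewrite -powRM ?divr_ge0 ?(ltW x0)//.
  by congr (_ `^ _); field; rewrite gt_eqF.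
(* Comparison with the integral of [x `^ (p - 1)], which is nondecreasing for
   [1 <= p] and nonincreasing for [p <= 1]: the unit interval used lies to the
   right of [i + 2] in the first case and to its left in the second. *)
suff [m mk sm] : exists2 m : nat, (m <= k.+2)%N &
    \sum_(i < k) i.+2%:R `^ (p - 1) <= m%:R `^ p / p.
  apply: (le_trans sm); rewrite ler_pM2r ?invr_gt0//.
  by apply: ge0_ler_powR; rewrite ?(ltW p0)// ?nnegrE// ler_nat.
have [p1|p1] := leP 1 p.
  exists k.+2 => //; elim: k => [|k IH].
    by rewrite big_ord0 divr_ge0 ?powR_ge0 ?(ltW p0).
  rewrite big_ord_recr/= -lerBrDr (le_trans IH)// lerBrDr.
  have x0 : 0 < k.+2%:R :> R by rewrite ltr0n.
  rewrite ler_pdivlMr// mulrDl divfK ?gt_eqF//.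
  rewrite (scale k.+2%:R k.+3%:R)// -(powR_pred p x0).
  set y := _ `^ (p - 1).
  have y0 : 0 <= y by exact: powR_ge0.
  (* Multiplied by [(k + 2)^p], this becomes [(k + 2)^p + p (k + 2)^(p - 1) <= (k + 3)^p], which is
     [p] times the increment needed. *)
  have := @bernoulli_ge1 p (k.+3%:R / k.+2%:R) p1 (divr_ge0 (ler0n _ _) (ler0n _ _)).
  have -> : k.+3%:R / k.+2%:R - 1 = k.+2%:R^-1 :> R.
    by rewrite -[k.+3]addn1 natrD; field; rewrite gt_eqF.
  have xy0 : 0 <= k.+2%:R * y by rewrite mulr_ge0.
  move=> /(ler_wpM2l xy0)/(le_trans _); apply.
  rewrite le_eqVlt; apply/orP; left; apply/eqP.
  by field; rewrite gt_eqF.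
exists k.+1 => //; elim: k => [|k IH].
  by rewrite big_ord0 divr_ge0 ?powR_ge0 ?(ltW p0).
rewrite big_ord_recr/= -lerBrDr (le_trans IH)// lerBrDr.
have x0 : 0 < k.+2%:R :> R by rewrite ltr0n.
rewrite ler_pdivlMr// mulrDl divfK ?gt_eqF//.
rewrite (scale k.+2%:R k.+1%:R)// -(powR_pred p x0).
set y := _ `^ (p - 1).
have y0 : 0 <= y by exact: powR_ge0.
have p01 : 0 < p <= 1 by rewrite p0 ltW.
have := @bernoulli_le1 p (k.+1%:R / k.+2%:R) p01 (divr_ge0 (ler0n _ _) (ler0n _ _)).
have -> : k.+1%:R / k.+2%:R - 1 = - k.+2%:R^-1 :> R.
  rewrite -[X in X / _](addrK 1) natr1; field; exact: lt0r_neq0.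
have xy0 : 0 <= k.+2%:R * y by rewrite mulr_ge0.
move=> /(ler_wpM2l xy0) h; rewrite -lerBrDr (le_trans h)//.
rewrite le_eqVlt; apply/orP; left; apply/eqP.
by field; rewrite gt_eqF.
Qed.

(** Young's inequality for the factors [a^(rho / 2) r^rho] and [A / a^(rho / 2)]: the power
    [2 / rho] of the first is exactly [a r^2]. *)
Lemma young_powR rho a A r : 0 < rho < 2 -> 0 < a -> 0 <= A -> 0 <= r ->
  A / rho * r `^ rho <= a / 2 * r ^+ 2 +
    (2 - rho) / (2 * rho) * (A `^ (2 / (2 - rho)) / a `^ (rho / (2 - rho))).
Proof.
move=> /andP[rho0 rho2] a0 A0 r0.
have b0 : 0 < a `^ (rho / 2) by rewrite powR_gt0.
have p0 : 0 < 2 / rho by rewrite divr_gt0.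
have q0 : 0 < 2 / (2 - rho) by rewrite divr_gt0//; lra.
have := @conjugate_powR R (a `^ (rho / 2) * r `^ rho) (A / a `^ (rho / 2)) _ _
  (mulr_ge0 (powR_ge0 _ _) (powR_ge0 _ _)) (divr_ge0 A0 (powR_ge0 _ _)) p0 q0.
move=> /(_ _)/wrap[].
  by field; rewrite !gt_eqF//; lra.
rewrite !powRM ?powR_ge0 ?invr_ge0 ?powR_ge0// -!powRN -!powRrM.
have -> : rho / 2 * (2 / rho) = 1 by field; rewrite gt_eqF.
have -> : rho * (2 / rho) = 2 by field; rewrite gt_eqF.
have -> : - (rho / 2) * (2 / (2 - rho)) = - (rho / (2 - rho)).
  by field; rewrite gt_eqF//; lra.
rewrite powRr1 ?(ltW a0)// (powR_mulrn 2 r0) !powRN => h.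
have ir0 : 0 <= rho^-1 by rewrite invr_ge0 ltW.
have := ler_wpM2l ir0 h.
have c0 : a `^ (rho / (2 - rho)) != 0 by rewrite gt_eqF// powR_gt0.
have -> : rho^-1 * (a `^ (rho / 2) * r `^ rho * (A / a `^ (rho / 2)))
  = A / rho * r `^ rho by field; rewrite !gt_eqF.
move=> /le_trans; apply.
rewrite le_eqVlt; apply/orP; left; apply/eqP.
by field; rewrite c0 !gt_eqF//; lra.
Qed.

End Powers.

(** * The estimating-sequence argument, for arbitrary weights and error terms *)

Section Estimate.
Context {R : realType} {E : normedModType R}.

(* Since the weight of the starting point is [S 0 = 0], step 0 of the method
   follows the same recursion as the later ones, with [x0] in the role of the
   preceding output. *)
Definition previous_point (x0 : E) (xhat : nat -> E) (n : nat) : E :=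
  if n is n'.+1 then xhat n' else x0.

Lemma weight_sum_recr (lam : nat -> R) n :
  weight_sum lam n.+1 = weight_sum lam n + lam n.
Proof. by rewrite /weight_sum big_ord_recr. Qed.

Lemma weight_sum_ge0 (lam : nat -> R) n :
  (forall k, 0 < lam k) -> 0 <= weight_sum lam n.
Proof. by move=> lam0; apply: sumr_ge0 => i _; exact: ltW. Qed.

Lemma weight_sum_gt0 (lam : nat -> R) n :
  (forall k, 0 < lam k) -> 0 < weight_sum lam n.+1.
Proof. by move=> lam0; rewrite weight_sum_recr ltr_wpDl// weight_sum_ge0. Qed.

Context (Q : set E) (f d : E -> \bar R) (grad : E -> {linear E -> R^o}).
Context (sigma_d : R) (x0 : E) (m_f : E -> E -> \bar R).
Context (L : E -> R) (delta : E -> E -> R) (lam beta : nat -> R).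
Context (phi psi : nat -> E -> \bar R) (z w xs xhat : nat -> E).
Context (cQ : convex_set Q) (cf : lsc_convex f) (Qf : Q `<=` dom f).
Context (prox : prox_function Q d grad sigma_d x0).
Context (SP : class_SP Q f d grad m_f 0 0 L delta).
Context (par : parameters lam beta).
Context (P2 : property2 Q d grad x0 m_f 0 lam beta xs phi psi z w).
Context (meth : modified_method_S x0 lam z w xs xhat).

Local Notation u := (previous_point x0 xhat).
Local Notation S := (weight_sum lam).

Let lam0 := lam_gt0 par.

Lemma methodS_xsE n : xs n = (S n + lam n)^-1 *: (S n *: u n + lam n *: z n).
Proof.
case: n => [|n]; last by rewrite (methodS_x meth) weight_sum_recr.
rewrite (methodS_x0 meth) (prop2_B1_z P2) /weight_sum big_ord0 scale0r !add0r.
by rewrite scalerA mulVf ?scale1r// gt_eqF.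
Qed.

Lemma methodS_xhatE n :
  xhat n = (S n + lam n)^-1 *: (S n *: u n + lam n *: w n.+1).
Proof.
case: n => [|n]; last by rewrite (methodS_xhat meth) weight_sum_recr.
rewrite (methodS_xhat0 meth) /weight_sum big_ord0 scale0r !add0r.
by rewrite scalerA mulVf ?scale1r// gt_eqF.
Qed.

Lemma methodS_Q_previous n : Q (u n).
Proof.
elim: n => [|n IH]; first exact: (prox_argmin prox).1.
rewrite /= methodS_xhatE; apply: convex_set_average => //.
- exact: (prop2_w P2 _).1.
- exact: weight_sum_ge0.
Qed.

Lemma methodS_Q_xs n : Q (xs n).
Proof.
rewrite methodS_xsE; apply: convex_set_average => //.
- exact: methodS_Q_previous.
- exact: (prop2_z P2 _).1.
- exact: weight_sum_ge0.
Qed.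

(** Both points average the same [u n] with the same weights, so only [z n] and [w n.+1] remain in
    the difference. *)
Lemma methodS_dist n :
  `|xs n - xhat n| = lam n / S n.+1 * `|z n - w n.+1|.
Proof.
rewrite methodS_xsE methodS_xhatE -scalerBr opprD addrACA subrr add0r.
rewrite -scalerBr scalerA normrZ -weight_sum_recr (mulrC _ (lam n)).
by rewrite ger0_norm// divr_ge0 ?ltW// weight_sum_gt0.
Qed.

Let f_fin x : Q x -> f x \is a fin_num.
Proof. by case: cf => fNy _ _ Qx; rewrite fin_real// fNy Qf. Qed.

Let d_fin x : Q x -> d x \is a fin_num.
Proof. by move=> Qx; rewrite fin_real// (prox_gtNy prox) (prox_dom prox). Qed.

Let m_fin y x : Q y -> Q x -> m_f y x \is a fin_num.
Proof.
move=> Qy Qx; have [mNy _ _] := SP_model_lsc_convex SP Qy.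
by rewrite fin_real// mNy (SP_model_dom SP Qy Qx).
Qed.

Let m_le y x : Q y -> Q x -> fine (m_f y x) <= fine (f x).
Proof. by move=> Qy Qx; rewrite fine_le ?m_fin ?f_fin// (SP_model_le SP). Qed.

Lemma methodS_psi_ge (err : nat -> R) :
  (forall n, S n.+1 * (L (xs n) / 2 * `|xs n - xhat n| ^+ 2
                       + delta (xs n) (xhat n)) <=
     beta n * sigma_d / 2 * `|z n - w n.+1| ^+ 2 + err n) ->
  forall n, ((S n * fine (f (u n)) - \sum_(i < n) err i)%:E <= psi n (w n))%E.
Proof.
move=> err_ge; elim=> [|n IH].
  by rewrite /weight_sum !big_ord0 mul0r subr0 (prop2_B1_psi P2).
have Qz := (prop2_z P2 n).1; have Qw := (prop2_w P2 n.+1).1.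
have Qxs := methodS_Q_xs n; have Qu := methodS_Q_previous n.
have Qxh : Q (xhat n) := methodS_Q_previous n.+1.
(* The bound passes from [psi n (w n)] to [phi n (z n)], since [w n] minimizes [psi n] and B0 holds
   at [z n]. *)
have phi_ge : ((S n * fine (f (u n)) - \sum_(i < n) err i)%:E <= phi n (z n))%E.
  apply: (le_trans IH); apply: (le_trans ((prop2_w P2 n).2 _ Qz)).
  exact: prop2_B0 P2 n _ Qz.
apply: le_trans (prop2_B2 P2 n Qw).
have fmw := fineK (m_fin Qxs Qw); have fdw := fineK (d_fin Qw).
rewrite -fmw -fdw mulr0 mul0r adde0.
have : ((S n * fine (f (u n)) - \sum_(i < n) err i)%:E
  + (lam n)%:E * (fine (m_f (xs n) (w n.+1)))%:E
  + (beta n.+1)%:E * (fine (d (w n.+1)))%:E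
  - (beta n * l_prox d grad (z n) (w n.+1))%:E <=
  phi n (z n)
  + (lam n)%:E * (fine (m_f (xs n) (w n.+1)))%:E
  + (beta n.+1)%:E * (fine (d (w n.+1)))%:E
  - (beta n * l_prox d grad (z n) (w n.+1))%:E)%E by do 3 apply: leeD2r.
apply: le_trans; rewrite -!EFinM -!EFinD lee_fin big_ord_recr/=.
have := SP_upper SP Qxh Qxs.
rewrite mul0r sube0 -(fineK (f_fin Qxh)) -(fineK (m_fin Qxs Qxh)) -EFinD lee_fin.
move=> /(ler_wpM2l (weight_sum_ge0 n.+1 lam0)); rewrite mulrDr => upper.
have [mNy _ cm] := SP_model_lsc_convex SP Qxs.
have := econvex_average cm mNy (SP_model_dom SP Qxs Qu)
  (SP_model_dom SP Qxs Qw) (weight_sum_ge0 n lam0) (lam0 n).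
rewrite -methodS_xhatE -weight_sum_recr => model.
have old := ler_wpM2l (weight_sum_ge0 n lam0) (m_le Qxs Qu).
(* As [d] is nonnegative and [beta] nondecreasing, the prox terms of B2 are at least [beta n] times
   the Bregman distance from [z n] to [w n.+1], hence at least the quadratic reserve. *)
have breg := ler_wpM2l (beta_ge0 par n) (bregman_ge cQ prox Qw Qz).
have dw0 : 0 <= fine (d (w n.+1)) by rewrite fine_ge0// (prox_ge0 prox).
have beta_d := ler_wpM2r dw0 (beta_ndecr par n).
have err_n := err_ge n; rewrite (distrC (w n.+1)) /bregman in breg; lra.
Qed.

(** The lower bound on [psi n.+1 (w n.+1)] meets the upper bound given by B3 at [x], where every
    model is at most [f x]. *)
Lemma methodS_gap (err : nat -> R) x n :
  (forall n, S n.+1 * (L (xs n) / 2 * `|xs n - xhat n| ^+ 2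
                       + delta (xs n) (xhat n)) <=
     beta n * sigma_d / 2 * `|z n - w n.+1| ^+ 2 + err n) ->
  Q x ->
  S n.+1 * (fine (f (xhat n)) - fine (f x)) <=
    beta n.+1 * l_prox d grad (z n.+1) x + \sum_(i < n.+1) err i.
Proof.
move=> err_ge Qx; have lower := methodS_psi_ge err_ge n.+1.
have := le_trans lower (le_trans (prop2_B3 P2 n.+1)
  (ereal_inf_lbound (imageP _ Qx))).
rewrite /= mulr0 mul0r sube0.
rewrite (eq_bigr (fun i : 'I_n.+1 => (lam i * fine (m_f (xs i) x))%:E)); last first.
  by move=> i _; rewrite EFinM fineK// m_fin//; exact: methodS_Q_xs.
rewrite sumEFin -EFinD lee_fin.
have : \sum_(i < n.+1) lam i * fine (m_f (xs i) x) <= S n.+1 * fine (f x).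
  rewrite /weight_sum mulr_suml; apply: ler_sum => i _.
  by rewrite ler_wpM2l ?(ltW (lam0 _))// m_le//; exact: methodS_Q_xs.
lra.
Qed.

End Estimate.

(** * Specialization to the chosen weights and scaling, and the final rate *)

Lemma weight_sum_half (R : realType) (lam : nat -> R) n :
  (forall k, lam k = k.+1%:R / 2) -> weight_sum lam n = n%:R * n.+1%:R / 4.
Proof.
move=> lamE; elim: n => [|n IH]; first by rewrite /weight_sum big_ord0 !mul0r.
rewrite weight_sum_recr IH lamE -[n.+2]addn2 -[n.+1]addn1 !natrD; lra.
Qed.

(** The factors are [S n.+1] and [lam n / S n.+1] for the chosen weights. With [x = n + 2], Young's
    inequality is used for [a = gamma x^p], the share of [beta n * sigma_d] that carries [gamma],
    and [A = m (x / 2)^(2 - rho)]. *)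
Lemma holder_error_le (R : realType) (rho gamma m r : R) (n : nat) :
  0 < rho < 2 -> 0 < gamma -> 0 <= m -> 0 <= r ->
  n.+1%:R * n.+2%:R / 4 * (m / rho * (2 / n.+2%:R * r) `^ rho) <=
    gamma * n.+2%:R `^ (3 / 2 * (2 - rho)) / 2 * r ^+ 2 +
    (2 - rho) / (8 * rho) *
      (m `^ (2 / (2 - rho)) / gamma `^ (rho / (2 - rho))) *
      n.+2%:R `^ (3 / 2 * (2 - rho) - 1).
Proof.
move=> rho02 gamma0 m0 r0; have /andP[rho0 rho2] := rho02.
set x : R := n.+2%:R; have x0 : 0 < x by rewrite ltr0n.
have nx : n.+1%:R <= x by rewrite ler_nat.
have h0 : 0 < x / 2 by rewrite divr_gt0.
have A0 : 0 <= m * (x / 2) `^ (2 - rho) by rewrite mulr_ge0// powR_ge0.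
have a0 : 0 < gamma * x `^ (3 / 2 * (2 - rho)) by rewrite mulr_gt0// powR_gt0.
have -> : 2 / x = (x / 2)^-1 by rewrite invf_div.
rewrite powRM ?invr_ge0 ?(ltW h0)// -(powR_inv1 (ltW h0)) -powRrM mulN1r.
have := young_powR rho02 a0 A0 r0.
(* The numerator contributes [x^2 / 4] and the denominator [x^(3 rho / 2)], whence the exponent
   [p - 1]. *)
have -> : (m * (x / 2) `^ (2 - rho)) `^ (2 / (2 - rho)) /
    (gamma * x `^ (3 / 2 * (2 - rho))) `^ (rho / (2 - rho)) =
  m `^ (2 / (2 - rho)) / gamma `^ (rho / (2 - rho)) *
    x `^ (3 / 2 * (2 - rho) - 1) / 4.
  rewrite (powRM _ m0 (powR_ge0 _ _)) (powRM _ (ltW gamma0) (powR_ge0 _ _)).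
  rewrite -!powRrM.
  have -> : (2 - rho) * (2 / (2 - rho)) = 2 by field; rewrite gt_eqF//; lra.
  have -> : 3 / 2 * (2 - rho) * (rho / (2 - rho)) = 3 / 2 * rho.
    by field; rewrite gt_eqF//; lra.
  have -> : 3 / 2 * (2 - rho) - 1 = 2 - 3 / 2 * rho by lra.
  rewrite [x `^ (2 - _)]powRD ?(gt_eqF x0) ?implybT// powRN !powR_mulrn ?(ltW x0) ?(ltW h0)//.
  by field; rewrite !gt_eqF// powR_gt0.
(* Rounding [n + 1] up to [x] makes the prefactor [(x / 2)^2], which merges with
   [(x / 2)^(- rho)]. *)
move=> young; apply: (@le_trans _ _ (m * (x / 2) `^ (2 - rho) / rho * r `^ rho)).
  rewrite [_ `^ (2 - _)]powRD ?(gt_eqF h0) ?implybT// powR_mulrn ?(ltW h0)//.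
  set c := _ `^ (- rho); set b := r `^ rho.
  have c0 : 0 <= m / rho * (c * b).
    by rewrite mulr_ge0 ?divr_ge0 ?(ltW rho0)// mulr_ge0 ?powR_ge0.
  rewrite [leRHS](_ : _ = (x * x / 4) * (m / rho * (c * b))); last by field; rewrite gt_eqF.
  by rewrite ler_wpM2r// ler_pM2r// ler_pM2r.
apply: (le_trans young); rewrite lerD2l le_eqVlt; apply/orP; left; apply/eqP.
by field; rewrite !gt_eqF// powR_gt0.
Qed.

Theorem theorem5p5 (R : realType) (E : normedModType R)
    (Q : set E) (f d : E -> \bar R) (grad : E -> {linear E -> R^o})
    (sigma_d : R) (x0 xstar : E)
    (m_f : E -> E -> \bar R) (L rho gamma : R) (M : E -> R)
    (lam beta : nat -> R) (phi psi : nat -> E -> \bar R)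
    (z w xs xhat : nat -> E) :
  finite_dimensional E ->
  closed Q -> convex_set Q ->
  lsc_convex f -> Q `<=` dom f ->
  is_argmin Q f xstar ->
  prox_function Q d grad sigma_d x0 ->
  0 <= L -> 1 <= rho < 2 -> (forall y, Q y -> 0 <= M y) ->
  class_SP Q f d grad m_f 0 0 (fun=> L)
    (fun y x => M y / rho * `|y - x| `^ rho) ->
  0 < gamma ->
  (forall k, lam k = k.+1%:R / 2) ->
  (* beta n is the scaling parameter of index k = n - 1, so k + 3 = n + 2 *)
  (forall n, beta n = L / sigma_d
     + gamma / sigma_d * n.+2%:R `^ (3 / 2 * (2 - rho))) ->
  parameters lam beta ->
  property2 Q d grad x0 m_f 0 lam beta xs phi psi z w ->
  modified_method_S x0 lam z w xs xhat ->
  (* z k.+1 is the term of index k of the sequence z *)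
  forall k : nat,
    (f (xhat k) - f xstar <=
     (4 * L * l_prox d grad (z k.+1) xstar
        / (sigma_d * k.+1%:R * k.+2%:R)
      + (4 * gamma * l_prox d grad (z k.+1) xstar / sigma_d
         + \big[Num.max/M (xs 0%N) `^ (2 / (2 - rho))]_(i < k.+1)
             (M (xs i) `^ (2 / (2 - rho)))
           / (3 * rho * gamma `^ (rho / (2 - rho))))
        * (k.+3%:R `^ (3 / 2 * (2 - rho)) / (k.+1%:R * k.+2%:R)))%:E)%E.
Proof.
move=> _ _ cQ cf Qf [Qxstar _] prox L0 rho12 M0 SP gamma0 lamE betaE par P2 meth k.
have /andP[rho1 rho2] := rho12; have rho0 : 0 < rho by lra.
have s0 := prox_sigma_gt0 prox.
set p := 3 / 2 * (2 - rho); have p0 : 0 < p by rewrite /p mulr_gt0//; lra.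
have Qxs n : Q (xs n) by exact: (methodS_Q_xs cQ prox par P2 meth).
pose err n := (2 - rho) / (8 * rho) *
  (M (xs n) `^ (2 / (2 - rho)) / gamma `^ (rho / (2 - rho))) *
  n.+2%:R `^ (p - 1).
have err_ge n : weight_sum lam n.+1 * (L / 2 * `|xs n - xhat n| ^+ 2 +
      M (xs n) / rho * `|xs n - xhat n| `^ rho) <=
    beta n * sigma_d / 2 * `|z n - w n.+1| ^+ 2 + err n.
  rewrite (methodS_dist par P2 meth) (weight_sum_half _ lamE) lamE betaE.
  have x0_ : 0 < n.+2%:R :> R by rewrite ltr0n.
  have y0_ : 0 < n.+1%:R :> R by rewrite ltr0n.
  have -> : n.+1%:R / 2 / (n.+1%:R * n.+2%:R / 4) = 2 / n.+2%:R :> R.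
    by field; rewrite !gt_eqF.
  have r0 := normr_ge0 (z n - w n.+1); set r := `|z n - w n.+1| in r0 *.
  have rho02 : 0 < rho < 2 by rewrite rho0.
  have := holder_error_le n rho02 gamma0 (M0 _ (Qxs n)) r0.
  rewrite -/p -/(err n) => holder.
  have quad : n.+1%:R * n.+2%:R / 4 * (L / 2 * (2 / n.+2%:R * r) ^+ 2) <=
      L / 2 * r ^+ 2.
    rewrite [leLHS](_ : _ = n.+1%:R / n.+2%:R * (L / 2 * r ^+ 2)); last first.
      by field; rewrite gt_eqF.
    apply: ler_piMl; first by rewrite mulr_ge0 ?exprn_ge0// divr_ge0.
    by rewrite ler_pdivrMr// mul1r ler_nat.
  (* The reserve splits: its [L] share pays for [quad], its [gamma] share for [holder]. *)
  have -> : (L / sigma_d + gamma / sigma_d * n.+2%:R `^ p) * sigma_d =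
      L + gamma * n.+2%:R `^ p by field; rewrite gt_eqF.
  rewrite mulrDr; apply: le_trans (lerD quad holder) _.
  by rewrite le_eqVlt; apply/orP; left; apply/eqP; ring.
have gap := methodS_gap cQ cf Qf prox SP par P2 meth k err_ge Qxstar.
have Qxh : Q (xhat k) := methodS_Q_previous cQ prox par P2 meth k.+1.
have f_fin x : Q x -> f x \is a fin_num.
  by case: cf => fNy _ _ Qx; rewrite fin_real// fNy Qf.
rewrite -(fineK (f_fin _ Qxh)) -(fineK (f_fin _ Qxstar)) -EFinB lee_fin.
(* The default value is the term of index 0, so [B] is the genuine maximum. *)
set B := \big[Num.max/_]_(i < _) _.
have MB (i : 'I_k.+1) : M (xs i) `^ (2 / (2 - rho)) <= B.
  exact: (le_bigmax _ (fun i : 'I_k.+1 => M (xs i) `^ (2 / (2 - rho)))).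
have g0 : 0 < gamma `^ (rho / (2 - rho)) by rewrite powR_gt0.
have B0 : 0 <= B by apply: le_trans (MB ord0); exact: powR_ge0.
have c0 : 0 <= (2 - rho) / (8 * rho) by rewrite divr_ge0//; lra.
(* Dividing [(2 - rho) / (8 * rho)] by [p] leaves [1 / (12 * rho)]; the final division by
   [S k.+1 = (k + 1) (k + 2) / 4] turns 12 into 3. *)
have errB : \sum_(i < k.+1) err i <=
    B / (12 * rho * gamma `^ (rho / (2 - rho))) * k.+3%:R `^ p.
  apply: (@le_trans _ _ ((2 - rho) / (8 * rho) * (B / gamma `^ (rho / (2 - rho)))
    * \sum_(i < k.+1) i.+2%:R `^ (p - 1))).
    rewrite mulr_sumr; apply: ler_sum => i _.
    by rewrite ler_wpM2r ?powR_ge0// ler_wpM2l// ler_pM2r ?invr_gt0.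
  apply: (@le_trans _ _ ((2 - rho) / (8 * rho) * (B / gamma `^ (rho / (2 - rho)))
    * (k.+3%:R `^ p / p))).
    by rewrite ler_wpM2l ?sum_powR// mulr_ge0// divr_ge0// ltW.
  rewrite le_eqVlt; apply/orP; left; apply/eqP; move: (_ `^ p) => y.
  by rewrite /p; field; rewrite !gt_eqF//; lra.
have S0 : 0 < k.+1%:R * k.+2%:R / 4 :> R by rewrite divr_gt0// mulr_gt0// ltr0n.
rewrite (weight_sum_half _ lamE) betaE -/p in gap.
rewrite -(ler_pM2l S0); apply: (le_trans gap); rewrite -lerBrDl (le_trans errB)//.
rewrite le_eqVlt; apply/orP; left; apply/eqP; move: (_ `^ p) => y.
by field; rewrite !gt_eqF// ltr0n.
Qed.
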